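(* Let $(\Lambda,\eta)$ be a special isothermic surface in $S^{n}$ of type $d\in\mathbb{N}_{0}$ with respect to a polynomial $p(t)$. Let $\hat{\Lambda}$ be a Darboux transform of $(\Lambda,\eta)$ with spectral parameter $m$, and let $G$ be a $(\mathrm{d}+m\eta)$-parallel lift of $\hat{\Lambda}$. Then: 1) $(p(m),G)$ is constant; 2) if $(p(m),G)=0$, then $(\hat{\Lambda},\hat{\eta})$ is a special isothermic surface of type $d$, with respect to a polynomial $\hat{p}(t)$ for which $\hat{p}(0)=p(0)$ and $(\hat{p}(t),\hat{p}(t))=(p(t),p(t))$.
   Context: Let $n\ge 3$. $\mathbb{R}^{n+1,1}$ denotes $\mathbb{R}^{n+2}$ with an inner product $(\cdot,\cdot)$ of signature $(n+1,1)$, $\mathcal{L}$ its light-cone, and $S^n\cong\mathbb{P}(\mathcal{L})$. $\Sigma$ is a connected smooth surface, $\underline{\mathbb{R}}^{n+1,1}=\Sigma\times\mathbb{R}^{n+1,1}$, and $\mathrm{d}$ is its trivial flat connection. A map $\Sigma\to S^n$ is identified with a null line subbundle $\Lambda\subset\underline{\mathbb{R}}^{n+1,1}$; a lift of $\Lambda$ is a never-vanishing section $F$; $\Lambda$ is an immersion iff $\langle F,\mathrm{d}F(T\Sigma)\rangle$ is a subbundle of rank $3$. Identify $\bigwedge^2\mathbb{R}^{n+1,1}$ with $\mathrm{o}(\mathbb{R}^{n+1,1})$ by $(u\wedge v)w=(u,w)v-(v,w)u$. An isothermic surface $(\Lambda,\eta)$ in $S^n$ is an immersion $\Lambda$ with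 a non-zero closed $1$-form $\eta\in\Omega^1\otimes\mathrm{o}(\mathbb{R}^{n+1,1})$ taking values in $\Lambda\wedge\Lambda^{\perp}$; then $\mathrm{d}+t\eta$ is a flat metric connection for all $t\in\mathbb{R}$. A polynomial conserved quantity of $(\Lambda,\eta)$ is a non-zero polynomial $p(t)=\sum_k p_kt^k$ with $p_k\in\Gamma(\underline{\mathbb{R}}^{n+1,1})$ such that $(\mathrm{d}+t\eta)p(t)=0$ for all $t$. $(\Lambda,\eta)$ is special isothermic of type $d$ with respect to $p(t)$ if $p(t)$ is a polynomial conserved quantity of degree $d$. A Darboux transform of $(\Lambda,\eta)$ with (spectral) parameter $m\in\mathbb{R}\setminus\{0\}$ is an immersed $\hat\Lambda:\Sigma\to\mathbb{P}(\mathcal{L})$ with $\hat\Lambda\cap\Lambda=\{0\}$ which is $(\mathrm{d}+m\eta)$-parallel. For $c\ne0$ let $\Gamma_{\Lambda}^{\hat\Lambda}(c)$ be the orthogonal gauge transformation equal to $c$ on $\hat\Lambda$, $1$ on $(\Lambda\oplus\hat\Lambda)^\perp$ and $c^{-1}$ on $\Lambda$. It is known that $\hat\Lambda$ is isothermic with a $1$-form $\hat\eta$ (closed, $\hat\Lambda\wedge\hat\Lambda^\perp$-valued), always taken to be the one with $\Gamma_{\Lambda}^{\hat\Lambda}(1-\frac tm)\circ(\mathrm{d}+t\eta)\circ\Gamma_{\Lambda}^{\hat\Lambda}(1-\frac tm)^{-1}=\mathrm{d}+t\hat\eta$ for all $t\ne m$. *)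

(* Defs.v *)
From HB Require Import structures.
From mathcomp Require Import all_boot all_order all_algebra.
From mathcomp Require Import all_classical all_reals all_analysis.
Set Implicit Arguments.
Unset Strict Implicit.
Unset Printing Implicit Defensive.
Import Order.TTheory GRing.Theory Num.Theory.
Import numFieldNormedType.Exports.
Local Open Scope classical_set_scope.
Local Open Scope ring_scope.

(* [Ck k U f] and [smooth_on U f] are meant for open U.  All directional
   derivatives are used instead of the partial ones; on a finite-dimensional
   domain this is the same class. *)
Fixpoint Ck (R : realType) (V W : normedModType R) (k : nat) (U : set V)
    (f : V -> W) : Prop :=
  (forall y, U y -> {for y, continuous f}) /\
  match k with
  | 0%N => True
  | k'.+1 => forall v : V, (forall y, U y -> derivable f y v) /\ Ck k' U ('D_v f)
  end.

Definition smooth_on (R : realType) (V W : normedModType R) (U : set V)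
  (f : V -> W) : Prop := forall k, Ck k U f.

(* A smooth surface, given by a (not necessarily maximal) atlas.  The chart of
   index i is [smap i], with domain [sdom i] and inverse [sinv i]; the values of
   [smap i] off [sdom i], and of [sinv i] off the image of [sdom i], are junk. *)
Record surface (R : realType) := Surface {
  pts :> topologicalType;
  idx : Type;
  sdom : idx -> set pts;
  smap : idx -> pts -> 'cV[R]_2;
  sinv : idx -> 'cV[R]_2 -> pts;
  surface_hausdorff : hausdorff_space pts;
  surface_second_countable : @second_countable pts;
  sdom_open : forall i, open (sdom i);
  simg_open : forall i, open (smap i @` sdom i);
  smapK : forall i x, sdom i x -> sinv i (smap i x) = x;
  smap_continuous : forall i, {within sdom i, continuous (smap i)};
  sinv_continuous : forall i, {within smap i @` sdom i, continuous (sinv i)};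
  sdom_cover : forall x, exists i, sdom i x;
  transition_smooth : forall i j,
    smooth_on (smap i @` (sdom i `&` sdom j)) (smap j \o sinv i) }.

Definition simg (R : realType) (S : surface R) (i : idx S) : set 'cV[R]_2 :=
  smap i @` sdom i.

Definition smooth_map (R : realType) (S : surface R) (W : normedModType R)
    (U : set S) (f : S -> W) : Prop :=
  forall i : idx S, smooth_on (simg i `&` sinv i @^-1` U) (f \o sinv i).

(* A smooth W-valued 1-form w, given by its local representatives:
   [w i y v] is the value at v of the pull-back of w by the inverse of the i-th
   chart, at the point y of the image of that chart. *)
Record one_form (R : realType) (S : surface R) (W : normedModType R) := OneForm {
  form_at :> idx S -> 'cV[R]_2 -> 'cV[R]_2 -> W;
  form_linear : forall i y, simg i y -> linear (form_at i y);
  form_smooth : forall i v, smooth_on (simg i) (fun y => form_at i y v);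
  form_compat : forall i j y v, (smap i @` (sdom i `&` sdom j)) y ->
    form_at i y v =
    form_at j (smap j (sinv i y)) ('D_v (smap j \o sinv i : 'cV[R]_2 -> 'cV[R]_2) y) }.

(* The exterior derivative of w on the coordinate (constant) fields u, v. *)
Definition closed_form (R : realType) (S : surface R) (W : normedModType R)
    (w : one_form S W) : Prop :=
  forall (i : idx S) y u v, simg i y ->
    'D_u (fun z => w i z v) y - 'D_v (fun z => w i z u) y = 0.

Definition nonzero_form (R : realType) (S : surface R) (W : normedModType R)
    (w : one_form S W) : Prop :=
  exists (i : idx S) y v, simg i y /\ w i y v != 0.

Definition minkowski (R : realType) (n : nat) : 'M[R]_n.+2 :=
  diag_mx (\row_(i < n.+2) (if i == ord_max then -1 else 1)).

(* Q is the Gram matrix of an inner product of signature (n+1,1). *)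
Definition lorentzian (R : realType) (n : nat) (Q : 'M[R]_n.+2) : Prop :=
  exists2 P : 'M[R]_n.+2, P \in unitmx & Q = P^T *m minkowski R n *m P.

Definition ip (R : realType) (n : nat) (Q : 'M[R]_n.+2) (u v : 'cV[R]_n.+2) : R :=
  (u^T *m Q *m v) 0 0.

Definition perp (R : realType) (n : nat) (Q : 'M[R]_n.+2)
    (L : {vspace 'cV[R]_n.+2}) (w : 'cV[R]_n.+2) : Prop :=
  forall u, u \in L -> ip Q u w = 0.

(* The endomorphism w |-> (u,w)v - (v,w)u. *)
Definition wedge (R : realType) (n : nat) (Q : 'M[R]_n.+2) (u v : 'cV[R]_n.+2) :
    'M[R]_n.+2 :=
  v *m (u^T *m Q) - u *m (v^T *m Q).

(* A subbundle of the trivial bundle is given by its fibres. *)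
Definition local_lift (R : realType) (n : nat) (S : surface R)
    (L : S -> {vspace 'cV[R]_n.+2}) (U : set S) (F : S -> 'cV[R]_n.+2) : Prop :=
  smooth_map U F /\ forall x, U x -> F x != 0 /\ F x \in L x.

Definition lift_of (R : realType) (n : nat) (S : surface R)
    (L : S -> {vspace 'cV[R]_n.+2}) (F : S -> 'cV[R]_n.+2) : Prop :=
  local_lift L [set: S] F.

(* The differential of s at the point y of the i-th chart. *)
Definition dsec (R : realType) (n : nat) (S : surface R)
    (s : S -> 'cV[R]_n.+2) (i : idx S) (y v : 'cV[R]_2) : 'cV[R]_n.+2 :=
  'D_v (s \o sinv i : 'cV[R]_2 -> 'cV[R]_n.+2) y.

Definition coord_vec (R : realType) (k : 'I_2) : 'cV[R]_2 := delta_mx k 0.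

(* A smooth map from S to the projectivized light cone. *)
Definition null_line_bundle (R : realType) (n : nat) (Q : 'M[R]_n.+2)
    (S : surface R) (L : S -> {vspace 'cV[R]_n.+2}) : Prop :=
  [/\ forall x, \dim (L x) = 1%N,
      forall x u, u \in L x -> ip Q u u = 0
    & forall x : S, exists (U : set S) (F : S -> 'cV[R]_n.+2),
        [/\ open U, U x & local_lift L U F]].

(* The span of F and its differential has rank 3, for every local lift F. *)
Definition immersed (R : realType) (n : nat) (S : surface R)
    (L : S -> {vspace 'cV[R]_n.+2}) : Prop :=
  forall (U : set S) (F : S -> 'cV[R]_n.+2), open U -> local_lift L U F ->
  forall (i : idx S) y, simg i y -> U (sinv i y) ->
    \dim <<[:: F (sinv i y); dsec F i y (coord_vec R 0%R); dsec F i y (coord_vec R 1%R)]>>%VS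
    = 3%N.

(* The form takes values in the wedge of L with its orthogonal complement; as L
   has rank 1, every element of that space is a single u /\ w. *)
Definition wedge_valued (R : realType) (n : nat) (Q : 'M[R]_n.+2)
    (S : surface R) (L : S -> {vspace 'cV[R]_n.+2})
    (eta : one_form S 'M[R]_n.+2) : Prop :=
  forall (i : idx S) y v, simg i y ->
    exists u w, [/\ u \in L (sinv i y), perp Q (L (sinv i y)) w
                  & eta i y v = wedge Q u w].

Definition isothermic (R : realType) (n : nat) (Q : 'M[R]_n.+2)
    (S : surface R) (L : S -> {vspace 'cV[R]_n.+2})
    (eta : one_form S 'M[R]_n.+2) : Prop :=
  [/\ null_line_bundle Q L, immersed L, nonzero_form eta, closed_form eta
    & wedge_valued Q L eta].

(* (d + t eta) s at the point y of the i-th chart, in the direction v. *)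
Definition conn (R : realType) (n : nat) (S : surface R)
    (eta : one_form S 'M[R]_n.+2) (t : R) (s : S -> 'cV[R]_n.+2)
    (i : idx S) (y v : 'cV[R]_2) : 'cV[R]_n.+2 :=
  dsec s i y v + t *: (eta i y v *m s (sinv i y)).

Definition parallel_section (R : realType) (n : nat) (S : surface R)
    (eta : one_form S 'M[R]_n.+2) (t : R) (s : S -> 'cV[R]_n.+2) : Prop :=
  forall (i : idx S) y v, simg i y -> conn eta t s i y v = 0.

Definition parallel_bundle (R : realType) (n : nat) (S : surface R)
    (eta : one_form S 'M[R]_n.+2) (t : R)
    (L : S -> {vspace 'cV[R]_n.+2}) : Prop :=
  forall (U : set S) (s : S -> 'cV[R]_n.+2),
    open U -> smooth_map U s -> (forall x, U x -> s x \in L x) ->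
  forall (i : idx S) y v, simg i y -> U (sinv i y) ->
    conn eta t s i y v \in L (sinv i y).

(* Polynomials in t whose coefficients are sections are given by their list of
   coefficients (constant term first, trailing zeros allowed). *)
Definition peval (R : realType) (n : nat) (S : surface R)
    (p : seq (S -> 'cV[R]_n.+2)) (t : R) (x : S) : 'cV[R]_n.+2 :=
  \sum_(k < size p) t ^+ k *: nth (fun=> 0) p k x.

Definition pdegree (R : realType) (n : nat) (S : surface R)
    (p : seq (S -> 'cV[R]_n.+2)) (d : nat) : Prop :=
  (exists x, nth (fun=> 0) p d x != 0) /\
  (forall k x, (d < k)%N -> nth (fun=> 0) p k x = 0).

Definition conserved_quantity (R : realType) (n : nat) (S : surface R)
    (eta : one_form S 'M[R]_n.+2) (p : seq (S -> 'cV[R]_n.+2)) : Prop :=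
  [/\ forall k, smooth_map [set: S] (nth (fun=> 0) p k),
      exists k x, nth (fun=> 0) p k x != 0
    & forall t : R, parallel_section eta t (peval p t)].

Definition special_isothermic (R : realType) (n : nat) (Q : 'M[R]_n.+2)
    (S : surface R) (L : S -> {vspace 'cV[R]_n.+2})
    (eta : one_form S 'M[R]_n.+2) (d : nat) (p : seq (S -> 'cV[R]_n.+2)) : Prop :=
  [/\ isothermic Q L eta, conserved_quantity eta p & pdegree p d].

Definition darboux_transform (R : realType) (n : nat) (Q : 'M[R]_n.+2)
    (S : surface R) (L : S -> {vspace 'cV[R]_n.+2})
    (eta : one_form S 'M[R]_n.+2) (m : R)
    (Lhat : S -> {vspace 'cV[R]_n.+2}) : Prop :=
  [/\ null_line_bundle Q Lhat, immersed Lhat,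
      forall x, (Lhat x :&: L x = 0)%VS
    & parallel_bundle eta m Lhat].

(* For complementary null lines L and Lhat and c != 0, these conditions determine
   A, and A is then orthogonal. *)
Definition gauge (R : realType) (n : nat) (Q : 'M[R]_n.+2)
    (L Lhat : {vspace 'cV[R]_n.+2}) (c : R) (A : 'M[R]_n.+2) : Prop :=
  [/\ forall u, u \in Lhat -> A *m u = c *: u,
      forall u, u \in L -> A *m u = c^-1 *: u
    & forall u, perp Q (L + Lhat)%VS u -> A *m u = u].

(* The 1-form etahat carried by the Darboux transform Lhat of (L, eta). *)
Definition darboux_form (R : realType) (n : nat) (Q : 'M[R]_n.+2)
    (S : surface R) (L : S -> {vspace 'cV[R]_n.+2})
    (eta : one_form S 'M[R]_n.+2) (m : R)
    (Lhat : S -> {vspace 'cV[R]_n.+2}) (etahat : one_form S 'M[R]_n.+2) : Prop :=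
  [/\ closed_form etahat, wedge_valued Q Lhat etahat
    & forall t : R, t != m ->
      forall A : S -> 'M[R]_n.+2,
        (forall x, gauge Q (L x) (Lhat x) (1 - t / m) (A x)) ->
      forall s : S -> 'cV[R]_n.+2, smooth_map [set: S] s ->
      forall (i : idx S) y v, simg i y ->
        A (sinv i y) *m conn eta t (fun x => invmx (A x) *m s x) i y v
        = conn etahat t s i y v].

(* Main.v *)
Require Import Defs.
From HB Require Import structures.
From mathcomp Require Import all_boot all_order all_algebra.
From mathcomp Require Import all_classical all_reals all_analysis.
From mathcomp Require Import ring.
Set Implicit Arguments.
Unset Strict Implicit.
Unset Printing Implicit Defensive.
Import Order.TTheory GRing.Theory Num.Theory.
Import numFieldNormedType.Exports.
Local Open Scope classical_set_scope.
Local Open Scope ring_scope.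

(** The pairing $(p(m),G)$ is constant because [p(m)] and [G] are both parallel
    for the metric connection $d + m\eta$; since $\Sigma$ is connected, the
    vanishing of the derivative suffices.

    Suppose now $(p(m),G)=0$.  Let [F] be the lift of $\Lambda$ normalised by
    $(F,G)=1$; it is globally defined because [G] is.  With $c=1-t/m$ the gauge
    transformation $\Gamma(c)$ is
    $v \mapsto v+(c-1)(F,v)G+(c^{-1}-1)(G,v)F$, and the new conserved quantity is
    $\hat p(t)=\Gamma(1-t/m)p(t)$.  The gauge relation defining $\hat\eta$ makes
    it parallel for $d+t\hat\eta$ when $t\ne m$, $\Gamma$ is orthogonal, so that
    $(\hat p,\hat p)=(p,p)$, and $\Gamma(1)=1$ gives $\hat p(0)=p(0)$.  What has
    to be seen is that $\hat p$ is a polynomial of degree exactly [d].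

    - No pole: the only denominator is $1-t/m$, in the coefficient
      $(p(t),G)/(1-t/m)$ of [F].  The numerator vanishes at $t=m$, so this is a
      polynomial $q(t)$, of degree less than [d] ([lin_quot], [lin_quot_eq0]).
      Explicitly $\hat p(t)=p(t)+\frac tm(q(t)F-(p(t),F)G)$ ([darboux_polyE]);
      the relation $(d+t\hat\eta)\hat p(t)=0$ extends to $t=m$ because it is
      polynomial in [t] ([parallel_all]).
    - Degree at most [d]: this needs $(p_d,F)=0$ everywhere
      ([top_coef_orthogonal]).  The top coefficient of $(d+t\eta)p(t)=0$ reads
      $\eta p_d=0$, which forces $p_d\perp\Lambda$ wherever $\eta\ne0$.  And
      $\eta$ has no zero, even on a single coordinate direction: since
      $dG=-m\eta G$, a zero of $\eta$ would contradict that $\hat\Lambda$ is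
      immersed ([parallel_form_neq0]).  This replaces the usual appeal to
      holomorphic quadratic differentials.
    - Degree at least [d]: if $\hat p_d$ vanished identically, then $p_d$ would be
      a section $aF$ of $\Lambda$ and $dp_d=-\eta p_{d-1}$ would also lie in
      $\Lambda$; at a point where $a\ne0$ this says $dF\in\Lambda$, and $\Lambda$
      is immersed ([darboux_poly_degree]).

    Finally $\hat\eta\ne0$ because the gauge relation applied to [F] at one value
    of [t] would otherwise again put $dF$ in $\Lambda$ ([darboux_form_neq0]). *)

(** * Differential calculus of bilinear maps and C^k classes *)

Section Bilinear.
Variables (R : realType) (V W1 W2 W3 : normedModType R) (B : W1 -> W2 -> W3).
Hypothesis Bl : forall w, linear (B^~ w).
Hypothesis Br : forall u, linear (B u).
Hypothesis Bc : continuous (fun p : W1 * W2 => B p.1 p.2).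

Let BZl a u w : B (a *: u) w = a *: B u w.
Proof.
have B0 : B 0 w = 0.
  by have := Bl w (-1) 0 0; rewrite /= scaler0 addr0 scaleN1r addNr.
by rewrite -[a *: u]addr0 (Bl w a u 0) /= B0 addr0.
Qed.

Let BZr a u w : B u (a *: w) = a *: B u w.
Proof.
have B0 : B u 0 = 0.
  by have := Br u (-1) 0 0; rewrite scaler0 addr0 scaleN1r addNr.
by rewrite -[a *: w]addr0 (Br u a w 0) /= B0 addr0.
Qed.

Let BBl u u' w : B (u - u') w = B u w - B u' w.
Proof. by rewrite -scaleN1r addrC (Bl w (-1) u' u) /= scaleN1r addrC. Qed.

Let BBr u w w' : B u (w - w') = B u w - B u w'.
Proof. by rewrite -scaleN1r addrC (Br u (-1) w' w) /= scaleN1r addrC. Qed.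

Lemma cvg_bilinear (T : Type) (F : set_system T) {FF : Filter F}
    (f : T -> W1) (g : T -> W2) a b :
  f @ F --> a -> g @ F --> b -> (fun x => B (f x) (g x)) @ F --> B a b.
Proof.
move=> fa gb.
apply: (cvg_comp (fun x => (f x, g x)) (fun p => B p.1 p.2)); last exact: (@Bc (a, b)).
exact: cvg_pair.
Qed.

(** The difference quotient of [B f g] splits as
    [B (quotient of f) g + B f (quotient of g)], and [g], being derivable along [v],
    is continuous along that line. *)
Lemma is_derive_bilinear (f : V -> W1) (g : V -> W2) x v :
  derivable f x v -> derivable g x v ->
  is_derive x v (fun y => B (f y) (g y)) (B ('D_v f x) (g x) + B (f x) ('D_v g x)).
Proof.
move=> df dg.
have gc : g (h *: v + x) @[h --> 0^'] --> g x.
  have /derivable1P/derivable1_diffP/differentiable_continuous := dg.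
  rewrite /prop_for /continuous_at scale0r add0r => gc.
  exact: cvg_within_filter gc.
suff H : (fun h => h^-1 *: ((((fun y => B (f y) (g y)) \o shift x) (h *: v))
    - B (f x) (g x))) @ 0^' --> B ('D_v f x) (g x) + B (f x) ('D_v g x).
  by split; [apply/cvg_ex; eexists; exact: H|exact: cvg_lim H].
have -> : (fun h => h^-1 *: ((((fun y => B (f y) (g y)) \o shift x) (h *: v))
    - B (f x) (g x))) = (fun h =>
    B (h^-1 *: ((f \o shift x) (h *: v) - f x)) (g (h *: v + x)) +
    B (f x) (h^-1 *: ((g \o shift x) (h *: v) - g x))).
  apply/funext => h; rewrite BZl BZr -scalerDr; congr (_ *: _).
  by rewrite BBl BBr addrA subrK.
apply: cvgD.
  by apply: cvg_bilinear.
by apply: cvg_bilinear => //; exact: cvg_cst.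
Qed.

End Bilinear.

Section CkTheory.
Variables (R : realType) (V : normedModType R).

Lemma CkS (W : normedModType R) k (U : set V) (f : V -> W) : Ck k.+1 U f -> Ck k U f.
Proof.
elim: k f => [|k IH] f /= [fc fd]; split => // v.
have [? ?] := fd v; split => //.
exact: IH.
Qed.

Lemma CkW (W : normedModType R) k (U U' : set V) (f : V -> W) :
  U' `<=` U -> Ck k U f -> Ck k U' f.
Proof.
move=> sU; elim: k f => [|k IH] f /= [fc fd]; split => //.
- by move=> y /sU /fc.
- by move=> y /sU /fc.
- move=> v; have [fv fD] := fd v; split; last exact: IH.
  by move=> y /sU /fv.
Qed.

Lemma Ck_ext (W : normedModType R) k (U : set V) (f g : V -> W) :
  open U -> (forall y, U y -> f y = g y) -> Ck k U f -> Ck k U g.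
Proof.
move=> oU; elim: k f g => [|k IH] f g fg fk.
all: have nfg y : U y -> {near y, f =1 g}
  by move=> Uy; near=> z; apply: fg; near: z; exact: open_nbhs_nbhs.
all: have gc y : U y -> {for y, continuous g}.
1,3: move=> Uy; rewrite /prop_for /continuous_at -(fg y Uy).
1,2: by apply: cvg_trans (fk.1 y Uy); apply: near_eq_cvg; exact: nfg.
  by split.
have [_ fd] := fk; split => // v; have [fv fD] := fd v; split.
  by move=> y Uy; apply: near_eq_derivable (nfg y Uy) (fv y Uy).
by apply: IH fD => y Uy; apply: near_eq_derive; exact: nfg.
Unshelve. all: by end_near.
Qed.

(** Used for sections that are only known to be smooth through local lifts. *)
Lemma Ck_local (W : normedModType R) k (U : set V) (f : V -> W) :
  (forall y, U y -> exists U', U' y /\ Ck k U' f) -> Ck k U f.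
Proof.
elim: k f => [|k IH] f fU.
  by split => // y /fU[U' [U'y [fc _]]]; exact: fc.
split; first by move=> y /fU[U' [U'y [fc _]]]; exact: fc.
move=> v; split.
  by move=> y /fU[U' [U'y [_ fd]]]; have [d _] := fd v; exact: d.
apply: IH => y /fU[U' [U'y [_ fd]]]; exists U'; split => //.
by have [] := fd v.
Qed.

Lemma Ck_cst (W : normedModType R) k (U : set V) (c : W) : Ck k U (fun _ : V => c).
Proof.
elim: k c => [|k IH] c; split => //; try by move=> y _; exact: cvg_cst.
move=> v; split; first by move=> y _; exact: derivable_cst.
rewrite (_ : 'D_v _ = fun=> 0); first exact: IH.
by apply/funext => y; exact: derive_cst.
Qed.

Lemma CkD (W : normedModType R) k (U : set V) (f g : V -> W) : open U ->
  Ck k U f -> Ck k U g -> Ck k U (fun y => f y + g y).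
Proof.
move=> oU; elim: k f g => [|k IH] f g [fc fd] [gc gd]; split => //;
  try by move=> y Uy; apply: continuousD; [exact: fc|exact: gc].
move=> v; have [fv fD] := fd v; have [gv gD] := gd v; split.
  by move=> y Uy; apply: derivableD; [exact: fv|exact: gv].
apply: (Ck_ext oU _ (IH _ _ fD gD)) => y Uy /=.
by rewrite -deriveD//; [exact: fv|exact: gv].
Qed.

(** The Leibniz rule writes the derivative as a sum of two terms of the same shape,
    which closes the induction on [k]. *)
Lemma Ck_bilinear (W1 W2 W3 : normedModType R) (B : W1 -> W2 -> W3) :
  (forall w, linear (B^~ w)) -> (forall u, linear (B u)) ->
  continuous (fun p : W1 * W2 => B p.1 p.2) ->
  forall k (U : set V) (f : V -> W1) (g : V -> W2), open U ->
  Ck k U f -> Ck k U g -> Ck k U (fun y => B (f y) (g y)).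
Proof.
move=> Bl Br Bc k U f g oU; elim: k f g => [|k IH] f g fk gk.
  case: fk => fc _; case: gk => gc _; split => // y Uy.
  by apply: cvg_bilinear => //; [exact: fc|exact: gc].
have [fc fd] := fk; have [gc gd] := gk; split => [y Uy|v].
  by apply: cvg_bilinear => //; [exact: fc|exact: gc].
have [fv fD] := fd v; have [gv gD] := gd v.
have dB y : U y -> is_derive y v (fun y => B (f y) (g y))
    (B ('D_v f y) (g y) + B (f y) ('D_v g y)).
  by move=> Uy; apply: is_derive_bilinear => //; [exact: fv|exact: gv].
split; first by move=> y /dB[].
apply: (@Ck_ext _ _ _ (fun y => B ('D_v f y) (g y) + B (f y) ('D_v g y))) => //.
  by move=> y /dB[_ ->].
by apply: CkD => //; apply: IH => //; exact: CkS.
Qed.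

Lemma CkZ (W : normedModType R) k (U : set V) (f : V -> R) (g : V -> W) : open U ->
  Ck k U f -> Ck k U g -> Ck k U (fun y => f y *: g y).
Proof.
apply: (@Ck_bilinear R W W (fun a w => a *: w)).
- by move=> w a u u'; rewrite scalerDl scalerA.
- by move=> u a w w'; rewrite scalerDr !scalerA mulrC.
- by move=> p; exact: scale_continuous.
Qed.

(** The derivative [- f^-2 * f'] is a product of functions covered by the induction
    hypothesis on [f^-1]. *)
Lemma CkV k (U : set V) (f : V -> R) : open U -> (forall y, U y -> f y != 0) ->
  Ck k U f -> Ck k U (fun y => (f y)^-1).
Proof.
move=> oU f0; elim: k => [|k IH] fk.
  by case: fk => fc _; split => // y Uy; apply: continuousV; [exact: f0|exact: fc].
have [fc fd] := fk; split => [y Uy|v].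
  by apply: continuousV; [exact: f0|exact: fc].
have [fv fD] := fd v.
split; first by move=> y Uy; apply: derivableV; [exact: f0|exact: fv].
apply: (@Ck_ext _ _ _ (fun y => (- 1) *: ((f y)^-1 *: ((f y)^-1 *: 'D_v f y)))) => //.
  move=> y Uy; rewrite deriveV; [|exact: f0|exact: fv].
  by rewrite scalerA -expr2 exprVn scaleN1r scaleNr.
have fI := IH (CkS fk).
by apply: CkZ => //; [exact: Ck_cst|apply: CkZ => //; apply: CkZ].
Qed.

End CkTheory.

(** * Lorentzian linear algebra *)

Section LinearAlgebra.
Variables (R : realType) (n : nat) (Q : 'M[R]_n.+2).
Implicit Types (u v w a b F G : 'cV[R]_n.+2) (c k : R).
Local Notation ip := (ip Q).

Lemma ip_bilinear_l w : linear (fun u => ip u w : R^o).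
Proof. by move=> k u v; rewrite /Defs.ip linearP mulmxDl -scalemxAl mulmxDl -scalemxAl !mxE. Qed.

Lemma ip_bilinear_r u : linear (fun v => ip u v : R^o).
Proof. by move=> k v w; rewrite /Defs.ip linearP !mxE. Qed.

Lemma ipDl u v w : ip (u + v) w = ip u w + ip v w.
Proof. by have := ip_bilinear_l w 1 u v; rewrite !scale1r. Qed.

Lemma ipZl k u w : ip (k *: u) w = k * ip u w.
Proof. by rewrite /Defs.ip linearZ /= -!scalemxAl !mxE. Qed.

Lemma ipDr u v w : ip u (v + w) = ip u v + ip u w.
Proof. by have := ip_bilinear_r u 1 v w; rewrite !scale1r. Qed.

Lemma ipZr k u w : ip u (k *: w) = k * ip u w.
Proof. by rewrite /Defs.ip -scalemxAr mxE. Qed.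

Lemma ipNl u w : ip (- u) w = - ip u w.
Proof. by rewrite -scaleN1r ipZl mulN1r. Qed.

Lemma ipNr u w : ip u (- w) = - ip u w.
Proof. by rewrite -scaleN1r ipZr mulN1r. Qed.

Lemma ip0l w : ip 0 w = 0.
Proof. by rewrite -[0 in LHS](scale0r w) ipZl mul0r. Qed.

Lemma ip0r w : ip w 0 = 0.
Proof. by rewrite -[0 in LHS](scale0r w) ipZr mul0r. Qed.

Lemma ip_suml N (f : 'I_N -> 'cV[R]_n.+2) w :
  ip (\sum_i f i) w = \sum_i ip (f i) w.
Proof.
elim: N f => [|N IH] f; first by rewrite !big_ord0 ip0l.
by rewrite !big_ord_recr /= ipDl IH.
Qed.

Definition ipE := (ipDl, ipDr, ipZl, ipZr, ipNl, ipNr, ip0l, ip0r).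

Lemma ip_continuous : continuous (fun p : 'cV[R]_n.+2 * 'cV[R]_n.+2 => ip p.1 p.2).
Proof.
have -> : (fun p : 'cV[R]_n.+2 * 'cV[R]_n.+2 => ip p.1 p.2) = (fun p =>
    \sum_j (\sum_i p.1 i 0 * Q i j) * p.2 j 0).
  apply/funext => p; rewrite /Defs.ip mxE; apply: eq_bigr => j _.
  by rewrite mxE; congr (_ * _); apply: eq_bigr => i _; rewrite mxE.
have c1 i : continuous (fun p : 'cV[R]_n.+2 * 'cV[R]_n.+2 => p.1 i 0).
  by move=> p; apply: (cvg_comp fst (fun u : 'cV[R]_n.+2 => u i 0));
    [exact: cvg_fst|exact: coord_continuous].
have c2 i : continuous (fun p : 'cV[R]_n.+2 * 'cV[R]_n.+2 => p.2 i 0).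
  by move=> p; apply: (cvg_comp snd (fun u : 'cV[R]_n.+2 => u i 0));
    [exact: cvg_snd|exact: coord_continuous].
move=> p; apply: (cvg_big add_continuous) => j _; apply: cvgM; last exact: c2.
apply: (cvg_big add_continuous) => i _; apply: cvgM; [exact: c1|exact: cvg_cst].
Qed.

Lemma rank1_mulE u w v : u *m (w^T *m Q) *m v = ip w v *: u.
Proof. by rewrite -mulmxA [_ *m v]mx11_scalar mul_mx_scalar. Qed.

Lemma wedge_mul u w v : wedge Q u w *m v = ip u v *: w - ip w v *: u.
Proof. by rewrite /wedge mulmxBl !rank1_mulE. Qed.

Lemma eq_mx_cV (A B : 'M[R]_n.+2) : (forall v, A *m v = B *m v) -> A = B.
Proof.
move=> AB; apply/matrixP => i j.
by have := AB (delta_mx j 0); rewrite -!colE => /matrixP/(_ i 0); rewrite !mxE.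
Qed.

Lemma wedgeZl k u w : wedge Q (k *: u) w = wedge Q u (k *: w).
Proof.
apply: eq_mx_cV => v; rewrite !wedge_mul !ipE !scalerA.
by congr (_ *: _ - _ *: _); rewrite mulrC.
Qed.

Lemma wedge_self k u : wedge Q u (k *: u) = 0.
Proof. by apply: eq_mx_cV => v; rewrite wedge_mul ipE scalerA mulrC subrr mul0mx. Qed.

Hypothesis hQ : lorentzian Q.

Lemma minkowskiT : (Defs.minkowski R n)^T = Defs.minkowski R n.
Proof. exact: tr_diag_mx. Qed.

Lemma ip_sym u v : ip u v = ip v u.
Proof.
have QT : Q^T = Q.
  by have [P _ ->] := hQ; rewrite !trmx_mul trmxK minkowskiT mulmxA.
by rewrite /Defs.ip -[in RHS]QT -[in RHS](trmxK u) -!trmx_mul mulmxA [RHS]mxE.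
Qed.

(** A null vector with no time component has zero Euclidean norm. *)
Lemma null_eq0 P z : P \in unitmx -> Q = P^T *m Defs.minkowski R n *m P ->
  ip z z = 0 -> (P *m z) ord_max 0 = 0 -> z = 0.
Proof.
move=> Pu QE zz z0.
have H : ip z z = \sum_i (P *m z) i 0 ^+ 2.
  rewrite /Defs.ip QE !mulmxA -trmx_mul -mulmxA mxE; apply: eq_bigr => j _.
  rewrite /Defs.minkowski mul_mx_diag !mxE.
  have [->|_] := eqVneq j ord_max; last by rewrite mulr1 expr2.
  by have := z0; rewrite !mxE => ->; rewrite mulr0 expr0n.
have Pz : P *m z = 0.
  apply/matrixP => i j; rewrite ord1 [RHS]mxE.
  move: zz; rewrite H => /eqP; rewrite psumr_eq0 => [|k _]; last exact: sqr_ge0.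
  by move=> /allP/(_ i); rewrite mem_index_enum sqrf_eq0 => /(_ isT)/eqP.
by rewrite -[z](mulKmx Pu) Pz mulmx0.
Qed.

(** Signature (n+1,1) enters here: the combination of [u] and [v] with no time
    component is still null, hence zero. *)
Lemma null_orthogonal_collinear u v : ip u u = 0 -> ip v v = 0 -> ip u v = 0 ->
  u != 0 -> exists k, v = k *: u.
Proof.
move=> uu vv uv u0; have [P Pu QE] := hQ.
set a := (P *m u) ord_max 0; set b := (P *m v) ord_max 0.
have a0 : a != 0.
  by apply: contraNneq u0 => a0; apply/eqP/(null_eq0 Pu QE).
have : a *: v - b *: u = 0.
  apply: (null_eq0 Pu QE).
    by rewrite !ipE (ip_sym v u) uu vv uv !(mulr0, oppr0, addr0).
  have entryZ k (z : 'cV[R]_n.+2) : (k *: z) ord_max 0 = k * z ord_max 0 by rewrite mxE.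
  rewrite mulmxBr -!scalemxAr [LHS]mxE entryZ [X in _ + X]mxE entryZ.
  by rewrite -/a -/b mulrC subrr.
move=> /eqP; rewrite subr_eq0 => /eqP E; exists (a^-1 * b).
by rewrite -scalerA -E scalerA mulVf// scale1r.
Qed.

End LinearAlgebra.

Lemma dim1_collinear (R : realType) (n : nat) (U : {vspace 'cV[R]_n}) u v :
  \dim U = 1%N -> u \in U -> v \in U -> u != 0 -> exists k, v = k *: u.
Proof.
move=> dU uU vU u0.
have sU : (<[u]> <= U)%VS by rewrite -memvE.
have : (<[u]> == U)%VS by rewrite eqEdim sU dU dim_vline u0.
by move=> /eqP E; move: vU; rewrite -E => /vlineP.
Qed.

Lemma span3_indep (R : realType) (n : nat) (u v w : 'cV[R]_n) :
  \dim <<[:: u; v; w]>>%VS = 3%N -> forall k, v != k *: u.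
Proof.
move=> d3 k; apply/eqP => E.
have : free [:: v; u; w].
  rewrite /free/=; rewrite (_ : <<_>>%VS = <<[:: u; v; w]>>%VS) ?d3//.
  by apply: eq_span => z; rewrite !inE orbCA.
by rewrite free_cons E memvZ // memv_span // mem_head.
Qed.

(** * Polynomials in the spectral parameter *)

Lemma poly_eq0_off_point (R : realType) (p : {poly R}) (t0 : R) :
  (forall t, t != t0 -> p.[t] = 0) -> p = 0.
Proof.
move=> pt; apply/eqP/negPn/negP => p0.
(* Shifting by [j.+1] keeps the roots away from [t0]. *)
pose rs := [seq t0 + j.+1%:R | j <- iota 0 (size p)].
have urs : uniq rs.
  by rewrite map_inj_uniq ?iota_uniq// => i j /addrI/eqP; rewrite eqr_nat eqSS => /eqP.
have rrs : all (root p) rs.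
  apply/allP => _ /mapP[j _ ->]; apply/rootP/pt.
  by rewrite -subr_eq0 addrAC subrr add0r pnatr_eq0.
by have := max_poly_roots p0 rrs urs; rewrite size_map size_iota ltnn.
Qed.

Lemma poly_coef_eq0_off_point (R : realType) (n N : nat) (c : nat -> 'cV[R]_n) (t0 : R) :
  (forall t, t != t0 -> \sum_(k < N) t ^+ k *: c k = 0) ->
  forall k, (k < N)%N -> c k = 0.
Proof.
move=> ct k kN; apply/matrixP => i j; rewrite ord1 [RHS]mxE.
have : \poly_(k < N) c k i 0 = 0.
  apply: (@poly_eq0_off_point _ _ t0) => t /ct ctt.
  transitivity ((\sum_(k < N) t ^+ k *: c k) i 0); last by rewrite ctt mxE.
  by rewrite horner_poly summxE; apply: eq_bigr => l _; rewrite mxE mulrC.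
by move=> /polyP/(_ k); rewrite coef_poly kN coef0.
Qed.

Lemma sum_trunc (V : zmodType) (f : nat -> V) a b :
  (forall k, (a <= k)%N -> f k = 0) -> (a <= b)%N ->
  \sum_(k < b) f k = \sum_(k < a) f k.
Proof.
move=> f0 /subnKC <-; elim: (b - a)%N => [|c IH]; first by rewrite addn0.
by rewrite addnS big_ord_recr /= IH f0 ?addr0// leq_addr.
Qed.

(** Coefficients of the power series quotient of the series with coefficients [b]
    by 1 - t/m. *)
Fixpoint lin_quot (R : realType) (m : R) (b : nat -> R) (k : nat) : R :=
  b k + (if k is k'.+1 then lin_quot m b k' / m else 0).

(** Division with remainder, the remainder being the term of degree [N.+1]. *)
Lemma lin_quotP (R : realType) (m : R) (b : nat -> R) N t :
  (1 - t / m) * (\sum_(k < N.+1) t ^+ k * lin_quot m b k)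
  = \sum_(k < N.+1) t ^+ k * b k - t ^+ N.+1 / m * lin_quot m b N.
Proof.
elim: N => [|N IH].
  by rewrite !big_ord_recr !big_ord0 /= !add0r expr0 expr1 !mul1r addr0 mulrBl mul1r.
rewrite big_ord_recr /= mulrDr IH [in RHS]big_ord_recr /= !exprS; ring.
Qed.

(** At [t = m] the left-hand side of the division identity vanishes. *)
Lemma lin_quot_eq0 (R : realType) (m : R) (b : nat -> R) N : m != 0 ->
  \sum_(k < N.+1) m ^+ k * b k = 0 -> lin_quot m b N = 0.
Proof.
move=> m0 bm; have := lin_quotP m b N m.
rewrite divff// subrr mul0r bm sub0r => /esym/eqP.
by rewrite oppr_eq0 !mulf_eq0 invr_eq0 expf_eq0 (negPf m0) andbF => /eqP.
Qed.

(** * Smooth maps on a surface *)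

Section Sections.
Variables (R : realType) (S : surface R).

Lemma chart_open (i : idx S) (U : set S) : open U -> open (simg i `&` sinv i @^-1` U).
Proof.
move=> oU; apply: (continuous_inP _ _).1 oU; first exact: simg_open.
by rewrite -continuous_open_subspace; [exact: sinv_continuous|exact: simg_open].
Qed.

Lemma smooth_mapD (W : normedModType R) (U : set S) (f g : S -> W) : open U ->
  smooth_map U f -> smooth_map U g -> smooth_map U (fun x => f x + g x).
Proof. by move=> oU sf sg i k; apply: CkD; [exact: chart_open|exact: sf|exact: sg]. Qed.

Lemma smooth_map_cst (W : normedModType R) (U : set S) (c : W) :
  smooth_map U (fun _ : S => c).
Proof. by move=> i k; exact: Ck_cst. Qed.

Lemma smooth_mapZ (W : normedModType R) (U : set S) (f : S -> R) (g : S -> W) :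
  open U -> smooth_map U f -> smooth_map U g -> smooth_map U (fun x => f x *: g x).
Proof. by move=> oU sf sg i k; apply: CkZ; [exact: chart_open|exact: sf|exact: sg]. Qed.

Lemma smooth_mapV (U : set S) (f : S -> R) :
  open U -> (forall x, U x -> f x != 0) -> smooth_map U f ->
  smooth_map U (fun x => (f x)^-1).
Proof.
move=> oU f0 sf i k; apply: CkV; [exact: chart_open| |exact: sf].
by move=> y [_ /f0].
Qed.

Lemma smooth_map_sum (W : normedModType R) (U : set S) N (f : 'I_N -> S -> W) : open U ->
  (forall k, smooth_map U (f k)) -> smooth_map U (fun x => \sum_k f k x).
Proof.
move=> oU; elim: N f => [|N IH] f sf.
  rewrite (_ : (fun _ => _) = fun=> 0); first exact: smooth_map_cst.
  by apply/funext => x; rewrite big_ord0.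
rewrite (_ : (fun _ => _) = fun x => \sum_(k < N) f (widen_ord (leqnSn N) k) x + f ord_max x).
  by apply: smooth_mapD => //; exact: IH.
by apply/funext => x; rewrite big_ord_recr.
Qed.

Lemma smooth_map_ip n (Q : 'M[R]_n.+2) (U : set S) (f g : S -> 'cV[R]_n.+2) :
  open U -> smooth_map U f -> smooth_map U g -> smooth_map U (fun x => ip Q (f x) (g x)).
Proof.
move=> oU sf sg i k; apply: (@Ck_bilinear _ _ _ _ _ (ip Q)).
- exact: ip_bilinear_l.
- exact: ip_bilinear_r.
- exact: ip_continuous.
- exact: chart_open.
- exact: sf.
- exact: sg.
Qed.

Lemma smooth_mapW (W : normedModType R) (U U' : set S) (f : S -> W) :
  U' `<=` U -> smooth_map U f -> smooth_map U' f.
Proof.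
by move=> sU sf i k; apply: CkW (sf i k) => y [? ?]; split => //; exact: sU.
Qed.

Lemma smooth_map_ext (W : normedModType R) (U : set S) (f g : S -> W) : open U ->
  (forall x, U x -> f x = g x) -> smooth_map U f -> smooth_map U g.
Proof.
move=> oU fg sf i k; apply: Ck_ext (sf i k); first exact: chart_open.
by move=> y [_ /fg].
Qed.

Lemma smooth_map_local (W : normedModType R) (f : S -> W) :
  (forall x, exists U, [/\ open U, U x & smooth_map U f]) -> smooth_map [set: S] f.
Proof.
move=> H i k; apply: Ck_local => y [iy _].
have [U [oU Ux sf]] := H (sinv i y).
by exists (simg i `&` sinv i @^-1` U); split => //; exact: sf.
Qed.

Lemma smooth_derivable (W : normedModType R) (f : S -> W) i y v :
  smooth_map [set: S] f -> simg i y -> derivable (f \o sinv i) y v.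
Proof. by move=> sf iy; have [_ /(_ v)[+ _]] := sf i 1%N; apply. Qed.

Lemma simg_nbhs (i : idx S) y : simg i y -> nbhs y (simg i).
Proof. by move=> iy; apply: open_nbhs_nbhs; split => //; exact: simg_open. Qed.

Section Dsec.
Variables (n : nat) (Q : 'M[R]_n.+2) (i : idx S) (y v : 'cV[R]_2).
Hypothesis iy : simg i y.
Implicit Types f g : S -> 'cV[R]_n.+2.
Local Notation smooth := (smooth_map [set: S]).

Lemma dsec0 : dsec (fun=> 0 : 'cV[R]_n.+2) i y v = 0.
Proof. exact: derive_cst. Qed.

Lemma dsecZ (a : S -> R) f : smooth a -> smooth f ->
  dsec (fun x => a x *: f x) i y v
  = 'D_v (a \o sinv i) y *: f (sinv i y) + a (sinv i y) *: dsec f i y v.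
Proof.
move=> sa sf.
have H := @is_derive_bilinear R _ _ _ _ (fun (a : R) (w : 'cV[R]_n.+2) => a *: w)
  _ _ _ (a \o sinv i) (f \o sinv i) y v.
apply: (@derive_val _ _ _ _ _ _ _ (H _ _ _ _ _)).
- by move=> w c u u'; rewrite scalerDl scalerA.
- by move=> u c w w'; rewrite scalerDr !scalerA mulrC.
- by move=> p; exact: scale_continuous.
- exact: smooth_derivable.
- exact: smooth_derivable.
Qed.

Lemma dsecZc (k : R) f : smooth f -> dsec (fun x => k *: f x) i y v = k *: dsec f i y v.
Proof. by move=> sf; apply: deriveZ; exact: smooth_derivable. Qed.

Lemma dsec_sum N (f : 'I_N -> S -> 'cV[R]_n.+2) : (forall k, smooth (f k)) ->
  dsec (fun x => \sum_k f k x) i y v = \sum_k dsec (f k) i y v.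
Proof.
move=> sf; rewrite -derive_sum => [|k]; last exact: smooth_derivable.
by congr ('D_v _ y); apply/funext => z; rewrite fct_sumE.
Qed.

Lemma derive_ip f g : smooth f -> smooth g ->
  'D_v ((fun x => ip Q (f x) (g x)) \o sinv i) y
  = ip Q (dsec f i y v) (g (sinv i y)) + ip Q (f (sinv i y)) (dsec g i y v).
Proof.
move=> sf sg.
have H := @is_derive_bilinear R _ _ _ _ (ip Q) _ _ _ (f \o sinv i) (g \o sinv i) y v.
apply: (@derive_val _ _ _ _ _ _ _ (H _ _ _ _ _)).
- exact: ip_bilinear_l.
- exact: ip_bilinear_r.
- exact: ip_continuous.
- exact: smooth_derivable.
- exact: smooth_derivable.
Qed.

End Dsec.

(** A ball is star-shaped about its centre, so the mean value theorem applies along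
    the segment from [y0] to [z]. *)
Lemma derive_zero_ball (V : normedModType R) (f : V -> R) y0 (r : R) :
  (forall z v, ball y0 r z -> is_derive z v f 0) ->
  forall z, ball y0 r z -> f z = f y0.
Proof.
move=> df z zr; set v := z - y0.
pose g (t : R) := f (t *: v + y0).
have inb (t : R) : 0 <= t <= 1 -> ball y0 r (t *: v + y0).
  move=> /andP[t0 t1]; move: zr; rewrite -!ball_normE /= => zr.
  rewrite opprD addrCA subrr addr0 normrN normrZ ger0_norm//.
  by apply: le_lt_trans zr; rewrite -normrN opprB ler_piMl.
have dg (t : R) : 0 <= t <= 1 -> is_derive t (1 : R) g 0.
  move=> /inb/(df _ v) [D E].
  have lineE : (fun h : R => h^-1 *: ((g \o shift t) (h *: 1) - g t)) =
      (fun h => h^-1 *: ((f \o shift (t *: v + y0)) (h *: v) - f (t *: v + y0))).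
    by apply/funext => h; rewrite /g /= [_ *: 1]mulr1 scalerDl addrA.
  by split; [rewrite /derivable lineE|rewrite /derive lineE].
have [||c c01] := @MVT_segment R g (fun=> 0) 0 1 ler01.
- by move=> t /andP[/ltW t0 /ltW t1]; apply: dg; apply/andP.
- apply: continuous_in_subspaceT => t /[!inE] /= /andP[t0 t1].
  have [D _] := dg t ltac:(by apply/andP).
  exact/differentiable_continuous/derivable1_diffP.
- by rewrite mul0r /g scale1r scale0r add0r subrK => /subr0_eq.
Qed.

Lemma locally_constant_constant (T : topologicalType) (f : T -> R) :
  connected [set: T] -> (forall x, \forall z \near x, f z = f x) ->
  exists c, forall x, f x = c.
Proof.
move=> cT lf; have [[x0 _]|] := pselect (exists x : T, True); last first.
  by move=> H; exists 0 => x; exfalso; apply: H; exists x.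
exists (f x0); suff : [set x | f x = f x0] = [set: T].
  by move=> E x; have : [set: T] x by []; rewrite -E.
have ofib (P : set R) : open (f @^-1` P).
  rewrite openE => x Px; have := lf x; apply: filterS => z /= fz.
  by rewrite /preimage /mkset fz.
apply: cT; first by exists x0.
- by exists [set x | f x = f x0]; [exact: (ofib [set f x0])|rewrite setTI].
- exists [set x | f x = f x0]; last by rewrite setTI.
  rewrite -openC; exact: (ofib (~` [set f x0])).
Qed.

Lemma derive_zero_constant (f : S -> R) : connected [set: S] ->
  smooth_map [set: S] f ->
  (forall i y v, simg i y -> 'D_v (f \o sinv i) y = 0) ->
  exists c, forall x, f x = c.
Proof.
move=> cS sf df; apply: locally_constant_constant => // x.
have [i ix] := sdom_cover x.
have iy : simg i (smap i x) by exists x.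
have /nbhs_ballP[r /= r0 rU] := simg_nbhs iy.
have cst z : ball (smap i x) r z -> f (sinv i z) = f x.
  move=> zr; rewrite -[in RHS](smapK ix).
  apply: (@derive_zero_ball _ (f \o sinv i) _ r) => // {z zr} z v /rU iz.
  by split; [exact: smooth_derivable|exact: df].
have smc : {for x, continuous (smap i)}.
  have := @smap_continuous _ _ i; rewrite continuous_open_subspace; last exact: sdom_open.
  by apply; rewrite inE.
have near1 : \forall z \near x, ball (smap i x) r (smap i z).
  by apply: smc; exact: nbhsx_ballx.
have near2 : \forall z \near x, sdom i z.
  by apply: open_nbhs_nbhs; split => //; exact: sdom_open.
by near=> z; rewrite -(smapK (near near2 z _))//; apply: cst; near: z.
Unshelve. all: by end_near.
Qed.

End Sections.

(** * The gauge transformation *)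

Section Gauge.
Variables (R : realType) (n : nat) (Q : 'M[R]_n.+2) (hQ : lorentzian Q).
Variables (F G : 'cV[R]_n.+2).
Hypotheses (FF : ip Q F F = 0) (GG : ip Q G G = 0) (FG : ip Q F G = 1).
Implicit Types (c : R) (v w : 'cV[R]_n.+2).
Local Notation ip := (ip Q).

(** For [F], [G] null with [ip F G = 1], the two rank one matrices are the
    projections onto the lines of [G] and [F]. *)
Definition gauge_mx c : 'M[R]_n.+2 :=
  1%:M + (c - 1) *: (G *m (F^T *m Q)) + (c^-1 - 1) *: (F *m (G^T *m Q)).

Lemma gauge_mxE c v :
  gauge_mx c *m v = v + ((c - 1) * ip F v) *: G + ((c^-1 - 1) * ip G v) *: F.
Proof. by rewrite /gauge_mx !mulmxDl mul1mx -!scalemxAl !rank1_mulE !scalerA. Qed.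

Let GF : ip G F = 1. Proof. by rewrite ip_sym. Qed.

Lemma gauge_mxK c : c != 0 -> gauge_mx c *m gauge_mx c^-1 = 1%:M.
Proof.
move=> c0; apply: eq_mx_cV => v; rewrite mul1mx -mulmxA !gauge_mxE invrK !ipE.
rewrite FF GG FG GF; move: (ip F v) (ip G v) => a b.
by apply/matrixP => i j; rewrite !mxE; field.
Qed.

Lemma gauge_mx_inv c v : c != 0 -> invmx (gauge_mx c) *m (gauge_mx c *m v) = v.
Proof. by move=> c0; rewrite mulKmx//; have [] := mulmx1_unit (gauge_mxK c0). Qed.

Lemma gauge_mx_l c : gauge_mx c *m F = c^-1 *: F.
Proof.
rewrite gauge_mxE FF GF mulr0 mulr1 scale0r addr0 -[F in F + _]scale1r -scalerDl.
by congr (_ *: _); ring.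
Qed.

Lemma gauge_mx_r c : gauge_mx c *m G = c *: G.
Proof.
rewrite gauge_mxE GG FG mulr0 mulr1 scale0r addr0 -[G in G + _]scale1r -scalerDl.
by congr (_ *: _); ring.
Qed.

Lemma gauge_mxP c (L Lhat : {vspace 'cV[R]_n.+2}) : F \in L -> G \in Lhat ->
  (forall u, u \in L -> exists k, u = k *: F) ->
  (forall u, u \in Lhat -> exists k, u = k *: G) ->
  Defs.gauge Q L Lhat c (gauge_mx c).
Proof.
move=> FL GLh Lk Lhk; split.
- by move=> _ /Lhk[k ->]; rewrite -scalemxAr gauge_mx_r !scalerA mulrC.
- by move=> _ /Lk[k ->]; rewrite -scalemxAr gauge_mx_l !scalerA mulrC.
- move=> u pu; have inF : F \in (L + Lhat)%VS by rewrite (subvP (addvSl _ _)).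
  have inG : G \in (L + Lhat)%VS by rewrite (subvP (addvSr _ _)).
  by rewrite gauge_mxE (pu _ inF) (pu _ inG) !mulr0 !scale0r !addr0.
Qed.

End Gauge.

(** * The normalised lift of the original surface *)

(** The section of [L] dual to [G]: the pick in each fibre is an arbitrary nonzero
    vector, and dividing by its pairing with [G] removes the choice, so that
    local smooth lifts of [L] all induce the same section. *)
Definition dual_lift (R : realType) (n : nat) (Q : 'M[R]_n.+2) (S : surface R)
    (L : S -> {vspace 'cV[R]_n.+2}) (G : S -> 'cV[R]_n.+2) (x : S) : 'cV[R]_n.+2 :=
  (ip Q (vpick (L x)) (G x))^-1 *: vpick (L x).

Section NullLines.
Variables (R : realType) (n : nat) (Q : 'M[R]_n.+2) (hQ : lorentzian Q).
Variables (S : surface R) (L Lhat : S -> {vspace 'cV[R]_n.+2}).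
Hypotheses (nL : null_line_bundle Q L) (nLhat : null_line_bundle Q Lhat).
Hypothesis transversal : forall x, (Lhat x :&: L x = 0)%VS.
Variable G : S -> 'cV[R]_n.+2.
Hypothesis hG : lift_of Lhat G.
Local Notation ip := (ip Q).
Local Notation F := (dual_lift Q L G).

Let dL x : \dim (L x) = 1%N. Proof. by case: nL. Qed.
Let dLhat x : \dim (Lhat x) = 1%N. Proof. by case: nLhat. Qed.
Let G0 x : G x != 0. Proof. by have [_ /(_ x)[]] := hG. Qed.
Lemma lift_in x : G x \in Lhat x. Proof. by have [_ /(_ x)[]] := hG. Qed.

Lemma lift_null x : ip (G x) (G x) = 0.
Proof. by have [_ + _] := nLhat; apply; exact: lift_in. Qed.

Lemma lift_spans x u : u \in Lhat x -> exists k, u = k *: G x.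
Proof. by move=> uL; exact: dim1_collinear (dLhat x) (lift_in x) uL (G0 x). Qed.

(** Orthogonal null vectors are collinear, which transversality excludes. *)
Lemma transversal_pairing x u : u \in L x -> u != 0 -> ip u (G x) != 0.
Proof.
move=> uL u0; apply/eqP => uG.
have uu : ip u u = 0 by have [_ + _] := nL; apply; exact: uL.
have [k Gk] := null_orthogonal_collinear hQ uu (lift_null x) uG u0.
have : G x \in (Lhat x :&: L x)%VS by rewrite memv_cap lift_in Gk memvZ.
by rewrite transversal memv0 (negPf (G0 x)).
Qed.

Lemma dual_liftE x u : u \in L x -> u = ip u (G x) *: F x.
Proof.
move=> uL; set w := vpick (L x).
have w0 : w != 0 by rewrite /w vpick0 -dimv_eq0 dL.
have [k ->] := dim1_collinear (dL x) (memv_pick _) uL w0.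
rewrite ipE /dual_lift scalerA -/w -mulrA divff ?mulr1//.
by apply: transversal_pairing => //; exact: memv_pick.
Qed.

Lemma dual_lift_in x : F x \in L x.
Proof. by apply: memvZ; exact: memv_pick. Qed.

Lemma dual_lift_pairing x : ip (F x) (G x) = 1.
Proof.
rewrite /dual_lift ipE mulVf//; apply: transversal_pairing; first exact: memv_pick.
by rewrite vpick0 -dimv_eq0 dL.
Qed.

Lemma dual_lift_neq0 x : F x != 0.
Proof.
by apply: contra_eq_neq (dual_lift_pairing x) => ->; rewrite ipE eq_sym oner_neq0.
Qed.

Lemma dual_lift_null x : ip (F x) (F x) = 0.
Proof. by have [_ + _] := nL; apply; exact: dual_lift_in. Qed.

(** Near each point, any smooth local lift [F0] of [L] gives
    [F = (F0,G)^-1 F0]. *)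
Lemma dual_lift_smooth : smooth_map [set: S] F.
Proof.
apply: smooth_map_local => x.
have [_ _ /(_ x)[U [F0 [oU Ux [sF0 inF0]]]]] := nL.
exists U; split => //.
have sG : smooth_map U G by case: hG => + _; apply: smooth_mapW.
apply: (@smooth_map_ext _ _ _ _ (fun z => (ip (F0 z) (G z))^-1 *: F0 z)) => //.
  move=> z /inF0[F00 F0L]; rewrite [X in _ *: X](dual_liftE F0L) scalerA mulVf ?scale1r//.
  exact: transversal_pairing.
apply: smooth_mapZ => //; apply: smooth_mapV => //; last exact: smooth_map_ip.
by move=> z /inF0[? ?]; exact: transversal_pairing.
Qed.

Lemma dual_lift_lift : lift_of L F.
Proof.
split; first exact: dual_lift_smooth.
by move=> x _; split; [exact: dual_lift_neq0|exact: dual_lift_in].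
Qed.

Lemma dual_lift_derive i y v : simg i y -> ip (F (sinv i y)) (dsec F i y v) = 0.
Proof.
move=> iy; have := derive_ip Q v iy dual_lift_smooth dual_lift_smooth.
rewrite (_ : _ \o _ = cst 0); last by apply/funext => z; exact: dual_lift_null.
rewrite derive_cst (ip_sym hQ (dsec _ _ _ _)) => /esym/eqP.
by rewrite -mulr2n mulrn_eq0 => /eqP.
Qed.

(** Part of the freeness of [H] and its two partial derivatives; all the
    contradictions with an immersion below take this form. *)
Lemma immersed_lift_derive (H : S -> 'cV[R]_n.+2) (M : S -> {vspace 'cV[R]_n.+2}) i y :
  immersed M -> lift_of M H -> simg i y ->
  forall k, dsec H i y (coord_vec R 0%R) != k *: H (sinv i y).
Proof.
by move=> iM lH iy; apply: span3_indep (iM _ _ openT lH _ _ iy I).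
Qed.

Section WedgeForm.
Variable eta : one_form S 'M[R]_n.+2.
Hypothesis weta : wedge_valued Q L eta.

(** As [L] is spanned by [F], the scalar relating [u] to [F] can be absorbed in
    [w]. *)
Lemma wedge_formE i y v : simg i y ->
  exists2 w, ip (F (sinv i y)) w = 0 & eta i y v = wedge Q (F (sinv i y)) w.
Proof.
move=> iy; have [u [w [uL wL ->]]] := weta v iy.
exists (ip u (G (sinv i y)) *: w).
  by rewrite ipE wL ?mulr0//; exact: dual_lift_in.
by rewrite -wedgeZl -dual_liftE.
Qed.

Lemma wedge_form_skew i y v a b : simg i y ->
  ip (eta i y v *m a) b = - ip a (eta i y v *m b).
Proof.
move=> iy; have [w _ ->] := wedge_formE v iy.
rewrite !wedge_mul !ipE ![ip a _](ip_sym hQ); ring.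
Qed.

Lemma wedge_form_lift i y v : simg i y -> eta i y v *m F (sinv i y) = 0.
Proof.
move=> iy; have [w Fw ->] := wedge_formE v iy.
by rewrite wedge_mul dual_lift_null (ip_sym hQ w) Fw !scale0r subrr.
Qed.

(** If [F] and [a] were not orthogonal, [(F,a) w = (w,a) F] would make [w] a multiple
    of [F], and the form would vanish. *)
Lemma wedge_form_kernel i y v a : simg i y -> eta i y v != 0 ->
  eta i y v *m a = 0 -> ip (F (sinv i y)) a = 0.
Proof.
move=> iy; have [w Fw ->] := wedge_formE v iy; rewrite wedge_mul => W0 /eqP.
rewrite subr_eq0 => /eqP E; apply: contraNeq W0 => Fa.
have -> : w = ((ip (F (sinv i y)) a)^-1 * ip w a) *: F (sinv i y).
  by rewrite -scalerA -E scalerA mulVf// scale1r.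
by rewrite wedge_self.
Qed.

Lemma wedge_form_line i y v a : simg i y -> ip (F (sinv i y)) a = 0 ->
  exists k, eta i y v *m a = k *: F (sinv i y).
Proof.
move=> iy Fa; have [w Fw ->] := wedge_formE v iy.
by exists (- ip w a); rewrite wedge_mul Fa scale0r sub0r scaleNr.
Qed.

End WedgeForm.
End NullLines.

(** * Parallel sections depending polynomially on t *)

Section Conserved.
Variables (R : realType) (n : nat) (S : surface R) (eta : one_form S 'M[R]_n.+2).
Variable p : seq (S -> 'cV[R]_n.+2).
Hypothesis sp : forall k, smooth_map [set: S] (nth (fun=> 0) p k).
Local Notation pc := (nth (fun=> 0) p).

Lemma peval_smooth t : smooth_map [set: S] (peval p t).
Proof.
apply: (smooth_map_sum (f := fun k x => t ^+ k *: pc k x)); first exact: openT.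
move=> k; apply: (smooth_mapZ (f := fun=> t ^+ k)); first exact: openT.
  exact: smooth_map_cst.
exact: sp.
Qed.

(** The list of coefficients may be shorter than [N] or carry trailing zeros. *)
Lemma pevalE N t x : (forall k z, (N <= k)%N -> pc k z = 0) ->
  peval p t x = \sum_(k < N) t ^+ k *: pc k x.
Proof.
move=> pN; pose f k := t ^+ k *: pc k x.
have fN k : (N <= k)%N -> f k = 0 by move=> /(pN _ x) E; rewrite /f E scaler0.
have fs k : (size p <= k)%N -> f k = 0 by move=> sk; rewrite /f nth_default// scaler0.
rewrite /peval -[LHS](sum_trunc fs (leq_maxl _ N)).
by rewrite (sum_trunc fN)// leq_maxr.
Qed.

(** The coefficient of [t ^+ k] in [conn eta t (peval p t) i y v]. *)
Definition conn_coef i y v k : 'cV[R]_n.+2 :=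
  dsec (pc k) i y v + (if k is k'.+1 then eta i y v *m pc k' (sinv i y) else 0).

Lemma conn_peval t i y v : simg i y ->
  conn eta t (peval p t) i y v = \sum_(k < (size p).+1) t ^+ k *: conn_coef i y v k.
Proof.
move=> iy; rewrite /conn (@dsec_sum _ _ _ _ _ v iy _ (fun k x => t ^+ k *: pc k x)); last first.
  move=> k; apply: (smooth_mapZ (f := fun=> t ^+ k)); first exact: openT.
    exact: smooth_map_cst.
  exact: sp.
under eq_bigr do rewrite dsecZc//.
rewrite /conn_coef; under [RHS]eq_bigr do rewrite scalerDr.
rewrite big_split /=; congr (_ + _).
  rewrite big_ord_recr /= nth_default// dsec0 scaler0 addr0.
  by [].
rewrite big_ord_recl /= scaler0 add0r /peval mulmx_sumr scaler_sumr.
by apply: eq_bigr => k _; rewrite -scalemxAr scalerA -exprS.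
Qed.

Lemma parallel_coef t0 i y v : simg i y ->
  (forall t, t != t0 -> conn eta t (peval p t) i y v = 0) ->
  forall k, conn_coef i y v k = 0.
Proof.
move=> iy par k; have [kp|kp] := leqP k (size p); last first.
  rewrite /conn_coef; case: k kp => // k kp.
  by rewrite !nth_default ?dsec0 ?mulmx0 ?addr0// ltnW.
apply: (poly_coef_eq0_off_point (N := (size p).+1) (t0 := t0)) => // t /par.
by rewrite conn_peval.
Qed.

(** The covariant derivative is polynomial in [t], so one value of [t] cannot be
    exceptional; this is how the pole of the gauge transformation at [t = m] is
    crossed. *)
Lemma parallel_all t0 :
  (forall t, t != t0 -> parallel_section eta t (peval p t)) ->
  forall t, parallel_section eta t (peval p t).
Proof.
move=> par t i y v iy; rewrite conn_peval//; apply: big1 => k _.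
by rewrite (parallel_coef iy (fun t t0 => par t t0 i y v iy)) scaler0.
Qed.

End Conserved.

(** * The transformed polynomial *)

Lemma onem_div_neq0 (R : fieldType) (m t : R) : m != 0 -> t != m -> 1 - t / m != 0.
Proof.
move=> m0 tm; rewrite subr_eq0 eq_sym; apply: contraNneq tm => E.
by rewrite -(divfK m0 t) E mul1r.
Qed.

Section DarbouxCoefficients.
Variables (R : realType) (n : nat) (Q : 'M[R]_n.+2) (hQ : lorentzian Q).
Variables (m : R) (m0 : m != 0) (F G : 'cV[R]_n.+2) (p : nat -> 'cV[R]_n.+2).
Local Notation ip := (ip Q).

(** Coefficients of p(t) + (t/m) (q(t) F - (p(t),F) G), where q(t) is the quotient of
    (p(t),G) by 1 - t/m. *)
Definition darboux_coef (k : nat) : 'cV[R]_n.+2 :=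
  p k + (if k is k'.+1 then
    m^-1 *: (lin_quot m (fun j => ip (p j) G) k' *: F - ip (p k') F *: G) else 0).

Variable d : nat.
Hypotheses (pdF : ip (p d) F = 0) (pmG : ip (\sum_(k < d.+1) m ^+ k *: p k) G = 0).
Local Notation pt t := (\sum_(k < d.+1) t ^+ k *: p k).
Local Notation pht t := (\sum_(k < d.+1) t ^+ k *: darboux_coef k).
Local Notation q k := (lin_quot m (fun j => ip (p j) G) k).

Let ip_pt t u : ip (pt t) u = \sum_(k < d.+1) t ^+ k * ip (p k) u.
Proof. by rewrite ip_suml; apply: eq_bigr => k _; rewrite ipE. Qed.

Let qd : q d = 0.
Proof. by apply: lin_quot_eq0 => //; rewrite -ip_pt. Qed.

Let qt t : (1 - t / m) * (\sum_(k < d.+1) t ^+ k * q k) = ip (pt t) G.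
Proof. by rewrite lin_quotP qd mulr0 subr0 ip_pt. Qed.

(** The two hypotheses say that the terms of degree [d.+1] of q(t) F and of
    (p(t),F) G, after multiplication by t, vanish. *)
Lemma darboux_polyE t : exists2 r, (1 - t / m) * r = ip (pt t) G &
  pht t = pt t + (t / m) *: (r *: F - ip (pt t) F *: G).
Proof.
exists (\sum_(k < d.+1) t ^+ k * q k); first exact: qt.
rewrite /darboux_coef; under eq_bigr do rewrite scalerDr.
rewrite big_split /=; congr (_ + _).
rewrite big_ord_recl /= scaler0 add0r ip_pt.
rewrite [in X in _ = _ *: (X - _)]big_ord_recr /= qd mulr0 addr0.
rewrite [in X in _ = _ *: (_ - X)]big_ord_recr /= pdF mulr0 addr0.
rewrite !scaler_suml -sumrB scaler_sumr; apply: eq_bigr => k _.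
by apply/matrixP => i j; rewrite !mxE exprS; ring.
Qed.

Hypotheses (FF : ip F F = 0) (GG : ip G G = 0) (FG : ip F G = 1).

Lemma darboux_poly_gauge t : t != m -> pht t = gauge_mx Q F G (1 - t / m) *m pt t.
Proof.
move=> tm; have [r rE ->] := darboux_polyE t.
rewrite gauge_mxE (ip_sym hQ G) -rE (ip_sym hQ F).
apply/matrixP => i j; rewrite !mxE; move: (ip _ _) => a; field.
by rewrite m0 subr_eq0 eq_sym.
Qed.

(** Stated for every [t], including [t = m] where the gauge transformation has a pole:
    the cross terms cancel by the equation of [r] alone. *)
Lemma darboux_poly_norm t : ip (pht t) (pht t) = ip (pt t) (pt t).
Proof.
have [r rE ->] := darboux_polyE t; move: (pt t) rE => P rE.
rewrite !ipE (ip_sym hQ F P) (ip_sym hQ G P) (ip_sym hQ G F) FF GG FG -rE.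
move: (ip P P) (ip P F) => P2 a; field; exact: m0.
Qed.

Lemma darboux_coef_eq0 k :
  darboux_coef k.+1 = 0 -> ip (p k.+1) F = 0 -> ip (p k) F = 0.
Proof.
move=> pk0 pF; have /eqP := congr1 (ip^~ F) pk0.
rewrite /darboux_coef !ipE pF FF (ip_sym hQ G) FG mulr0 mulr1 !add0r mulrN.
by rewrite oppr_eq0 mulf_eq0 invr_eq0 (negPf m0) => /eqP.
Qed.

End DarbouxCoefficients.

Section DarbouxPolynomial.
Variables (R : realType) (n : nat) (Q : 'M[R]_n.+2) (hQ : lorentzian Q).
Variables (S : surface R) (L : S -> {vspace 'cV[R]_n.+2}) (eta : one_form S 'M[R]_n.+2).
Variables (d : nat) (p : seq (S -> 'cV[R]_n.+2)).
Hypothesis hp : special_isothermic Q L eta d p.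
Variables (m : R) (m0 : m != 0) (Lhat : S -> {vspace 'cV[R]_n.+2}).
Hypothesis hLhat : darboux_transform Q L eta m Lhat.
Variable etahat : one_form S 'M[R]_n.+2.
Hypothesis hetahat : darboux_form Q L eta m Lhat etahat.
Variable G : S -> 'cV[R]_n.+2.
Hypotheses (hG : lift_of Lhat G) (hGpar : parallel_section eta m G).
Local Notation ip := (ip Q).
Local Notation F := (dual_lift Q L G).
Local Notation pc := (nth (fun=> 0) p).

Let nL : null_line_bundle Q L. Proof. by have [[]] := hp. Qed.
Let weta : wedge_valued Q L eta. Proof. by have [[]] := hp. Qed.
Let nLhat : null_line_bundle Q Lhat. Proof. by have [] := hLhat. Qed.
Let tr x : (Lhat x :&: L x = 0)%VS. Proof. by have [_ _] := hLhat. Qed.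
Let sp k : smooth_map [set: S] (pc k). Proof. by have [_ [+ _ _] _] := hp. Qed.
Let sG : smooth_map [set: S] G. Proof. by case: hG. Qed.
Let sF : smooth_map [set: S] F. Proof. exact: (dual_lift_smooth hQ nL nLhat tr hG). Qed.
Let FF x : ip (F x) (F x) = 0. Proof. exact: (dual_lift_null nL). Qed.
Let GG x : ip (G x) (G x) = 0. Proof. exact: (lift_null nLhat hG). Qed.
Let FG x : ip (F x) (G x) = 1. Proof. exact: (dual_lift_pairing hQ nL nLhat tr hG). Qed.
Let pd0 k x : (d < k)%N -> pc k x = 0. Proof. by have [_ _ [_ +]] := hp; apply. Qed.
Let ppar t : parallel_section eta t (peval p t). Proof. by have [_ [_ _ +] _] := hp; apply. Qed.

(** Skewness of [eta] makes the two contributions of the connection cancel. *)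
Lemma pairing_constant : connected [set: S] ->
  exists c : R, forall x, ip (peval p m x) (G x) = c.
Proof.
move=> cS; apply: derive_zero_constant => // [|i y v iy].
  apply: smooth_map_ip => //; [exact: openT|exact: peval_smooth].
have sP := peval_smooth sp m.
rewrite (derive_ip Q v iy sP sG).
have /eqP := ppar m v iy; rewrite addr_eq0 => /eqP ->.
have /eqP := hGpar v iy; rewrite addr_eq0 => /eqP ->.
by rewrite !ipE (wedge_form_skew hQ nL nLhat tr hG weta _ _ _ iy) mulrN opprK addrN.
Qed.

(** A parallel lift satisfies [dG = - m eta G], so a zero of [eta] in this direction
    would make the derivative of [G] vanish there. *)
Lemma parallel_form_neq0 i y : simg i y -> eta i y (coord_vec R 0%R) != 0.
Proof.
move=> iy; apply/eqP => e0.
have [_ iLhat _ _] := hLhat.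
have := immersed_lift_derive iLhat hG iy 0; rewrite scale0r => /negP; apply.
by have := hGpar (coord_vec R 0%R) iy; rewrite /conn e0 mul0mx scaler0 addr0 => ->.
Qed.

Let coef_rel i y v k : simg i y -> conn_coef eta p i y v k = 0.
Proof. by move=> iy; apply: (parallel_coef (t0 := 0) sp iy) => t _; exact: ppar. Qed.

(** The coefficient of degree [d.+1] of the parallel equation is [eta p_d = 0]. *)
Lemma top_coef_orthogonal x : ip (F x) (pc d x) = 0.
Proof.
have [i ix] := sdom_cover x.
have iy : simg i (smap i x) by exists x.
have := wedge_form_kernel hQ nL nLhat tr hG weta (a := pc d x) iy (parallel_form_neq0 iy).
rewrite smapK//; apply.
have := coef_rel (coord_vec R 0%R) d.+1 iy; rewrite /conn_coef smapK//.
have -> : pc d.+1 = (fun=> 0) by apply/funext => z; exact: pd0.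
by rewrite dsec0 add0r.
Qed.

Definition darboux_poly : seq (S -> 'cV[R]_n.+2) :=
  mkseq (fun k x => darboux_coef Q m (F x) (G x) (fun j => pc j x) k) d.+1.

Lemma darboux_poly_nth k x : (k <= d)%N ->
  nth (fun=> 0) darboux_poly k x = darboux_coef Q m (F x) (G x) (fun j => pc j x) k.
Proof. by move=> kd; rewrite nth_mkseq. Qed.

Lemma darboux_poly_nth0 k : (d < k)%N -> nth (fun=> 0) darboux_poly k = fun=> 0.
Proof. by move=> kd; rewrite nth_default// size_mkseq. Qed.

Lemma lin_quot_smooth k :
  smooth_map [set: S] (fun x => lin_quot m (fun j => ip (pc j x) (G x)) k).
Proof.
elim: k => [|k IH] /=.
  apply: (smooth_mapD (g := fun=> 0 : R)); first exact: openT.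
    by apply: smooth_map_ip; [exact: openT|exact: sp|exact: sG].
  exact: smooth_map_cst.
apply: smooth_mapD; first exact: openT.
  by apply: smooth_map_ip; [exact: openT|exact: sp|exact: sG].
rewrite (_ : (fun _ => _) = fun x => m^-1 *: lin_quot m (fun j => ip (pc j x) (G x)) k).
  apply: (smooth_mapZ (f := fun=> m^-1)); [exact: openT|exact: smooth_map_cst|exact: IH].
by apply/funext => x; rewrite mulrC.
Qed.

Lemma darboux_poly_smooth k : smooth_map [set: S] (nth (fun=> 0) darboux_poly k).
Proof.
have [kd|kd] := leqP k d; last by rewrite darboux_poly_nth0//; exact: smooth_map_cst.
rewrite (nth_mkseq (fun=> 0) _ (n := d.+1))// /darboux_coef.
apply: smooth_mapD; [exact: openT|exact: sp|].
case: k kd => [|k] _; first exact: smooth_map_cst.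
apply: (smooth_mapZ (f := fun=> m^-1)); [exact: openT|exact: smooth_map_cst|].
apply: smooth_mapD; first exact: openT.
  apply: smooth_mapZ; [exact: openT|exact: lin_quot_smooth|exact: sF].
rewrite (_ : (fun _ => _) = fun x => (-1) *: (ip (pc k x) (F x) *: G x)); last first.
  by apply/funext => x; rewrite scaleN1r.
apply: (smooth_mapZ (f := fun=> -1)); [exact: openT|exact: smooth_map_cst|].
apply: smooth_mapZ; [exact: openT| |exact: sG].
by apply: smooth_map_ip; [exact: openT|exact: sp|exact: sF].
Qed.

Hypothesis pmG : forall x, ip (peval p m x) (G x) = 0.

Let pE t x : peval p t x = \sum_(k < d.+1) t ^+ k *: pc k x.
Proof. by apply: pevalE => k z /pd0. Qed.

Let phE t x : peval darboux_poly t x =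
  \sum_(k < d.+1) t ^+ k *: darboux_coef Q m (F x) (G x) (fun j => pc j x) k.
Proof.
rewrite (pevalE (N := d.+1)) => [|k z kd]; last by rewrite darboux_poly_nth0.
by apply: eq_bigr => k _; rewrite darboux_poly_nth// -ltnS.
Qed.

Let pdF x : ip (pc d x) (F x) = 0.
Proof. by rewrite ip_sym// top_coef_orthogonal. Qed.

Let pmG' x : ip (\sum_(k < d.+1) m ^+ k *: pc k x) (G x) = 0.
Proof. by rewrite -pE. Qed.

Lemma peval_darboux_poly t x : t != m ->
  peval darboux_poly t x = gauge_mx Q (F x) (G x) (1 - t / m) *m peval p t x.
Proof. by move=> tm; rewrite phE pE; apply: darboux_poly_gauge. Qed.

Let A c x := gauge_mx Q (F x) (G x) c.

Let A_gauge c x : Defs.gauge Q (L x) (Lhat x) c (A c x).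
Proof.
apply: gauge_mxP => //.
- exact: dual_lift_in.
- exact: (lift_in hG).
- by move=> u /(dual_liftE hQ nL nLhat tr hG) E; eexists; exact: E.
- by move=> u; exact: (lift_spans nLhat hG).
Qed.

Lemma darboux_poly_parallel t : parallel_section etahat t (peval darboux_poly t).
Proof.
move: t; apply: (parallel_all (t0 := m) darboux_poly_smooth) => t tm i y v iy.
have [_ _ H] := hetahat.
have sph := peval_smooth darboux_poly_smooth t.
rewrite -(H t tm (A (1 - t / m)) (A_gauge _) _ sph i y v iy).
rewrite (_ : (fun _ => _) = peval p t); first by rewrite ppar// mulmx0.
by apply/funext => x; rewrite peval_darboux_poly// gauge_mx_inv// onem_div_neq0.
Qed.

(** If the coefficient of degree [d] vanished identically, pairing it with [F] would
    give (p_(d-1), F) = 0, and then [p_d] and its derivative would both be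
    proportional to [F]. *)
Lemma darboux_poly_degree : pdegree darboux_poly d.
Proof.
split=> [|k x kd]; last by rewrite darboux_poly_nth0.
apply: contrapT => H.
have {}H x : darboux_coef Q m (F x) (G x) (fun j => pc j x) d = 0.
  by apply/eqP/negPn/negP => N; apply: H; exists x; rewrite darboux_poly_nth.
have [_ _ [[x0 px0] _]] := hp.
(* The coefficient of [F] that remains once the one of [G] is known to vanish. *)
pose a x := - (if d is d'.+1 then m^-1 *: lin_quot m (fun j => ip (pc j x) (G x)) d' else 0).
have prevF x : (if d is d'.+1 then ip (F x) (pc d' x) else 0) = 0.
  case E: d => [//|d']; rewrite (ip_sym hQ).
  apply: (darboux_coef_eq0 hQ m0 (G := G x) (FF x) (FG x) (p := fun j => pc j x)).
    by rewrite -E; exact: H.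
  by rewrite -E; exact: pdF.
have pda x : pc d x = a x *: F x.
  have := H x; rewrite /darboux_coef /a; have := prevF x.
  case E: d => [|d'] /=; first by rewrite addr0 oppr0 scale0r.
  rewrite (ip_sym hQ (F x)) => ->; rewrite scale0r subr0 scalerA => /eqP.
  by rewrite addr_eq0 => /eqP ->; rewrite scaleNr.
have sa : smooth_map [set: S] a.
  rewrite /a; case: (d) => [|d']; first by rewrite oppr0; exact: smooth_map_cst.
  rewrite (_ : (fun _ => _) = fun x => (- m^-1) *: lin_quot m (fun j => ip (pc j x) (G x)) d').
    apply: (smooth_mapZ (f := fun=> - m^-1)); [exact: openT|exact: smooth_map_cst|].
    exact: lin_quot_smooth.
  by apply/funext => x; rewrite scaleNr.
have [i ix] := sdom_cover x0.
have iy : simg i (smap i x0) by exists x0.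
set y := smap i x0 in iy; have ye : sinv i y = x0 by exact: smapK.
pose e := coord_vec R 0%R.
have a0 : a x0 != 0 by apply: contraNneq px0 => a0; rewrite pda a0 scale0r.
have [k0 Ek] : exists k0, dsec (pc d) i y e = k0 *: F x0.
  have := coef_rel e d iy; rewrite /conn_coef; have := prevF x0.
  case: (d) => [_|d' Fd'].
    by rewrite addr0 => ->; exists 0; rewrite scale0r.
  have := wedge_form_line hQ nL nLhat tr hG weta e (a := pc d' x0) iy.
  rewrite ye => /(_ Fd')[k ->] /eqP; rewrite addr_eq0 => /eqP ->.
  by exists (- k); rewrite scaleNr.
have := dsecZ e iy sa sF.
rewrite (_ : (fun _ => _) = pc d); last by apply/funext => x; rewrite pda.
rewrite Ek ye addrC => /eqP; rewrite -subr_eq -scalerBl => /eqP dF.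
have [[_ iL _ _ _] _ _] := hp.
have lF : lift_of L F by exact: (dual_lift_lift hQ nL nLhat tr hG).
have := immersed_lift_derive iL lF iy ((a x0)^-1 * (k0 - 'D_e (a \o sinv i) y)).
by rewrite ye -scalerA dF scalerA mulVf// scale1r eqxx.
Qed.

(** For a vanishing form the gauge relation applied to [F] reads
    [c (gauge c) dF = dF], which puts [dF] in the span of [F] when [c != 1]. *)
Lemma darboux_form_neq0 : nonzero_form etahat.
Proof.
have [[_ iL [i [y [_ [iy _]]]] _ _] _ _] := hp.
pose e := coord_vec R 0%R; exists i, y, e; split => //; apply/eqP => e0.
have [_ _ H] := hetahat.
(* [t = - m] gives [c = 2]. *)
have mm : - m != m by rewrite -subr_eq0 -opprD oppr_eq0 -mulr2n mulrn_eq0.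
have := H (- m) mm (A (1 - (- m) / m)) (A_gauge _) _ sF i y e iy.
rewrite mulNr divff// opprK -[1 + 1]/2.
have n2 : (2 : R) != 0 by rewrite pnatr_eq0.
rewrite (_ : (fun _ => _) = fun x => 2 *: F x); last first.
  apply/funext => x; rewrite -[F x in LHS](_ : A 2 x *m (2 *: F x) = F x) ?gauge_mx_inv//.
  by rewrite -scalemxAr gauge_mx_l// scalerA divff// scale1r.
rewrite /conn e0 mul0mx scaler0 addr0 dsecZc// -scalemxAr.
rewrite (wedge_form_lift hQ nL nLhat tr hG weta _ iy) scaler0 scaler0 addr0.
have lF : lift_of L F by exact: (dual_lift_lift hQ nL nLhat tr hG).
rewrite -scalemxAr gauge_mxE (dual_lift_derive hQ nL nLhat tr hG)// mulr0 scale0r addr0.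
move: (ip (G _) _) => b E.
have solve (f D : 'cV[R]_n.+2) : 2 *: (D + ((2^-1 - 1) * b) *: f) = D -> D = b *: f.
  move=> DE; rewrite -[LHS]subr0 -[X in _ - X](subrr D) -[X in _ - (X - _)]DE.
  by apply/matrixP => j k; rewrite !mxE; field.
by have := immersed_lift_derive iL lF iy b; rewrite -(solve _ _ E) eqxx.
Qed.

Lemma darboux_poly_special : special_isothermic Q Lhat etahat d darboux_poly.
Proof.
have [_ iLhat _ _] := hLhat; have [clo wed _] := hetahat.
split; last exact: darboux_poly_degree.
- by split => //; exact: darboux_form_neq0.
- split; [exact: darboux_poly_smooth| |exact: darboux_poly_parallel].
  by have [[x px] _] := darboux_poly_degree; exists d, x.
Qed.

Lemma darboux_poly_at0 x : peval darboux_poly 0 x = peval p 0 x.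
Proof.
by rewrite peval_darboux_poly ?[0 == _]eq_sym// mul0r subr0 gauge_mxE invr1 subrr
  !mul0r !scale0r !addr0.
Qed.

Lemma darboux_poly_pairing t x :
  ip (peval darboux_poly t x) (peval darboux_poly t x) = ip (peval p t x) (peval p t x).
Proof. by rewrite phE pE; apply: darboux_poly_norm. Qed.

End DarbouxPolynomial.

Theorem theorem3p1 (R : realType) (n : nat) (hn : (3 <= n)%N)
    (Q : 'M[R]_n.+2) (hQ : lorentzian Q)
    (S : surface R) (hS : connected [set: S])
    (L : S -> {vspace 'cV[R]_n.+2}) (eta : one_form S 'M[R]_n.+2)
    (d : nat) (p : seq (S -> 'cV[R]_n.+2))
    (hp : special_isothermic Q L eta d p)
    (m : R) (hm : m != 0)
    (Lhat : S -> {vspace 'cV[R]_n.+2})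
    (hLhat : darboux_transform Q L eta m Lhat)
    (etahat : one_form S 'M[R]_n.+2)
    (hetahat : darboux_form Q L eta m Lhat etahat)
    (G : S -> 'cV[R]_n.+2)
    (hG : lift_of Lhat G) (hGpar : parallel_section eta m G) :
  (exists c : R, forall x, ip Q (peval p m x) (G x) = c) /\
  ((forall x, ip Q (peval p m x) (G x) = 0) ->
   exists phat : seq (S -> 'cV[R]_n.+2),
     [/\ special_isothermic Q Lhat etahat d phat,
         forall x, peval phat 0 x = peval p 0 x
       & forall (t : R) x,
           ip Q (peval phat t x) (peval phat t x) = ip Q (peval p t x) (peval p t x)]).
Proof.
split; first exact: (pairing_constant hQ hp hLhat hG hGpar hS).
move=> pmG; exists (darboux_poly Q L d p m G); split.
- exact: (darboux_poly_special hQ hp hm hLhat hetahat hG hGpar pmG).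
- exact: (darboux_poly_at0 hQ hp hm hLhat hG hGpar pmG).
- exact: (darboux_poly_pairing hQ hp hm hLhat hG hGpar pmG).
Qed.
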